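(* Let $0<\alpha<\beta$, let $n\ge1$ be an integer, and let $\mathbf{x}=(x_1,\dots,x_l)\in[\alpha,\beta]^l$, $\mathbf{y}=(y_1,\dots,y_m)\in[\alpha,\beta]^m$, $\mathbf{a}=(a_1,\dots,a_l)\in[0,\infty)^l$ and $\mathbf{b}=(b_1,\dots,b_m)\in[0,\infty)^m$ be such that $(\mathbf{y},\mathbf{b})\prec(\mathbf{x},\mathbf{a})$. Let $$k(t,x)=\begin{cases}t-\alpha,&\alpha\le t\le x\le\beta,\\ t-\beta,&\alpha\le x<t\le\beta.\end{cases}$$ Let $f:[\alpha,\beta]\to\mathbb{R}$ be such that $f^{(n-1)}$ is absolutely continuous on $[\alpha,\beta]$, and let $f$ be $n$-strongly convex with modulus $c>0$. If $$\sum_{j=1}^{l}a_j(x_j-t)^{n-1}k(t,x_j)-\sum_{i=1}^{m}b_i(y_i-t)^{n-1}k(t,y_i)\ge0\quad\text{for all }t\in[\alpha,\beta],\qquad( * )$$ then $$\begin{aligned} &\sum_{j=1}^{l}a_jf(x_j)-\sum_{i=1}^{m}b_if(y_i)-c\left(\sum_{j=1}^{l}a_jx_j^n-\sum_{i=1}^{m}b_iy_i^n\right)\\ &\ge\frac{1}{\beta-\alpha}\sum_{w=1}^{n-1}\frac{n-w}{w!}\left[f^{(w-1)}(\beta)-cn(n-1)\cdots(n-w+2)\beta^{n-w+1}\right]\left(\sum_{j=1}^{l}a_j(x_j-\beta)^w-\sum_{i=1}^{m}b_i(y_i-\beta)^w\right)\\ &\quad-\frac{1}{\beta-\alpha}\sum_{w=1}^{n-1}\frac{n-w}{w!}\left[f^{(w-1)}(\alpha)-cn(n-1)\cdots(n-w+2)\alpha^{n-w+1}\right]\left(\sum_{j=1}^{l}a_j(x_j-\alpha)^w-\sum_{i=1}^{m}b_i(y_i-\alpha)^w\right).\qquad(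 ** ) \end{aligned}$$ If the reverse inequality in $( * )$ holds (for all $t\in[\alpha,\beta]$), then the reverse inequality in $( ** )$ holds.
   Context: Weighted majorization: $(\mathbf{y},\mathbf{b})\prec(\mathbf{x},\mathbf{a})$ means that there exists a row stochastic matrix $\mathbf{A}=(a_{ij})\in\mathcal{M}_{ml}(\mathbb{R})$ ($m$ rows, $l$ columns, nonnegative entries, each row sum equal to $1$) such that $a_j=\sum_{i=1}^m b_ia_{ij}$ for $j=1,\dots,l$ and $y_i=\sum_{j=1}^l x_ja_{ij}$ for $i=1,\dots,m$ (in matrix form, $\mathbf{a}=\mathbf{b}\mathbf{A}$ and $\mathbf{y}=\mathbf{x}\mathbf{A}^T$). Divided differences: $[z_i;f]=f(z_i)$ and $[z_0,\dots,z_n;f]=\frac{[z_1,\dots,z_n;f]-[z_0,\dots,z_{n-1};f]}{z_n-z_0}$ for distinct points. A function $f:[\alpha,\beta]\to\mathbb{R}$ is $n$-strongly convex (strongly convex of order $n$) with modulus $c>0$ if $[z_0,\dots,z_n;f]\ge c$ for all distinct $z_0,\dots,z_n\in[\alpha,\beta]$. The product $n(n-1)\cdots(n-w+2)$ has $w-1$ factors (so it equals $\frac{n!}{(n-w+1)!}$, and is $1$ for $w=1$); empty sums are zero; the convention $u^0=1$ is used. *)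

(* Defs.v *)
From HB Require Import structures.
From mathcomp Require Import all_boot all_order all_algebra.
From mathcomp Require Import all_classical all_reals all_analysis.

Set Implicit Arguments.
Unset Strict Implicit.
Unset Printing Implicit Defensive.

Import Order.TTheory GRing.Theory Num.Theory.
Import numFieldNormedType.Exports.

Local Open Scope classical_set_scope.
Local Open Scope ring_scope.

(* A function on [alpha, beta] is represented by a total function R -> R; every
   notion below only looks at its values on [alpha, beta]. *)

Definition row_stochastic (R : realType) (m l : nat) (A : 'M[R]_(m, l)) : Prop :=
  (forall i j, 0 <= A i j) /\ (forall i, \sum_j A i j = 1).

(* (y, b) is majorized by (x, a). *)
Definition weighted_majorized (R : realType) (m l : nat)
    (y b : 'rV[R]_m) (x a : 'rV[R]_l) : Prop :=
  exists A : 'M[R]_(m, l),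
    [/\ row_stochastic A, a = b *m A & y = x *m A^T].

(* [z_0, ..., z_n; f]; only the first n + 1 values of z are used. *)
Fixpoint divdiff (R : realType) (f : R -> R) (n : nat) (z : nat -> R) : R :=
  if n is p.+1 then
    (divdiff f p (fun i => z i.+1) - divdiff f p z) / (z p.+1 - z 0%N)
  else f (z 0%N).

Definition strongly_convex (R : realType) (alpha beta : R) (n : nat) (c : R)
    (f : R -> R) : Prop :=
  forall z : nat -> R,
    {in [pred i | (i <= n)%N], forall i, z i \in `[alpha, beta]} ->
    {in [pred i | (i <= n)%N] &, injective z} ->
    c <= divdiff f n z.

Definition quotient_in (R : realType) (A : set R) (f : R -> R) (x : R) :=
  (f y - f x) / (y - x) @[y --> within A x^'].

Definition derivable_in (R : realType) (A : set R) (f : R -> R) (x : R) : Prop :=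
  cvg (quotient_in A f x).

(* The derivative relative to A, hence one-sided at the endpoints when A is a
   closed interval. *)
Definition derive_in (R : realType) (A : set R) (f : R -> R) (x : R) : R :=
  lim (quotient_in A f x).

Definition deriven_in (R : realType) (A : set R) (n : nat) (f : R -> R) :
  R -> R := iter n (derive_in A) f.

Definition n_derivable_in (R : realType) (A : set R) (n : nat) (f : R -> R) :
    Prop :=
  forall k, (k < n)%N -> forall x, A x -> derivable_in A (deriven_in A k f) x.

Definition absolutely_continuous (R : realType) (alpha beta : R) (f : R -> R) :
    Prop :=
  forall e : R, 0 < e -> exists2 d : R, 0 < d &
    forall (N : nat) (u v : 'I_N -> R),
      (forall i, [/\ alpha <= u i, u i < v i & v i <= beta]) ->
      trivIset [set: 'I_N] (fun i => `]u i, v i[%classic) ->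
      \sum_i (v i - u i) < d ->
      \sum_i `|f (v i) - f (u i)| < e.

Definition fink_kernel (R : realType) (alpha beta t x : R) : R :=
  if t <= x then t - alpha else t - beta.

Definition weighted_gap (R : realType) (m l : nat) (y b : 'rV[R]_m)
    (x a : 'rV[R]_l) (g : R -> R) : R :=
  \sum_j a 0 j * g (x 0 j) - \sum_i b 0 i * g (y 0 i).

(* The sum over w attached to the endpoint e (alpha or beta). The falling
   factorial n ^_ w.-1 is n (n - 1) ... (n - w + 2), so the bracket is the
   (w - 1)-st derivative of f(u) - c u^n at e. *)
Definition endpoint_sum (R : realType) (m l : nat) (y b : 'rV[R]_m)
    (x a : 'rV[R]_l) (alpha beta : R) (n : nat) (c : R) (f : R -> R) (e : R) :
    R :=
  \sum_(1 <= w < n)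
    (n - w)%:R / (w`!)%:R
    * (deriven_in `[alpha, beta] w.-1 f e
       - c * (n ^_ w.-1)%:R * e ^+ (n - w + 1))
    * weighted_gap y b x a (fun u => (u - e) ^+ w).

(* Main.v *)
Require Import Defs.
From HB Require Import structures.
From mathcomp Require Import all_boot all_order all_algebra.
From mathcomp Require Import all_classical all_reals all_analysis.
From mathcomp Require Import ring lra.

(* With g(u) = f(u) - c u^n, the difference of the two sides is a linear
   functional L of g which, by Fink's identity, equals
     1 / ((n-1)! (beta - alpha)) * int K(t) dG(t),   G = g^(n-1),
   K being the left-hand side of the kernel hypothesis.  The integral is
   avoided.  Strong convexity on equispaced points and the mean value theorem
   show that G is nondecreasing.  Approximating G uniformly by a step function
   and integrating n-1 times approximates g, together with its derivatives, by
   a polynomial of degree < n plus a nonnegative combination of truncated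
   powers (u - s)_+^(n-1)/(n-1)!.  L vanishes on the polynomial, and on the
   truncated power at s its value is K(s)/((n-1)! (beta - alpha)) by the
   binomial theorem. *)

Import Order.TTheory GRing.Theory Num.Theory.
Import numFieldNormedType.Exports.

Set Implicit Arguments.
Unset Strict Implicit.
Unset Printing Implicit Defensive.

Local Open Scope classical_set_scope.
Local Open Scope ring_scope.

(** * Towers of successive derivatives and bounds along them *)

(* E lists the points where the derivative may fail to exist: the knots of the
   truncated powers. *)
Definition derivative_tower (R : realType) (a b : R) (N : nat) (E : seq R)
    (g : nat -> R -> R) : Prop :=
  forall k, (k < N)%N -> {within `[a, b], continuous (g k)} /\
    (forall x, x \in `]a, b[ -> x \notin E -> is_derive x 1 (g k) (g k.+1 x)).

Lemma derivative_towerB (R : realType) (a b : R) (N : nat) (E : seq R)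
    (g h : nat -> R -> R) :
  derivative_tower a b N E g -> derivative_tower a b N E h ->
  derivative_tower a b N E (fun k u => g k u - h k u).
Proof.
move=> tg th k kN; have [gc gd] := tg k kN; have [hc hd] := th k kN.
split; first by move=> x; exact: continuousB (gc x) (hc x).
by move=> x xab xE; apply: is_deriveB; [exact: gd | exact: hd].
Qed.

Lemma derivative_tower_sum (R : realType) (a b : R) (N M : nat) (E : seq R)
    (d : nat -> R) (h : nat -> nat -> R -> R) :
  (forall i, (i < M)%N -> derivative_tower a b N E (h i)) ->
  derivative_tower a b N E (fun k u => \sum_(i < M) d i * h i k u).
Proof.
elim: M => [|M IH] th k kN.
  have -> : (fun u : R => \sum_(i < 0) d i * h i k u) = cst 0.
    by apply/funext => u; rewrite big_ord0.
  split; first by move=> x; exact: cst_continuous.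
  by move=> x _ _; rewrite big_ord0; exact: is_derive_cst.
have [gc gd] := IH (fun i iM => th i (ltnW iM)) k kN.
have [hc hd] := th M (ltnSn M) k kN.
have -> : (fun u : R => \sum_(i < M.+1) d i * h i k u) =
    (fun u => \sum_(i < M) d i * h i k u) + (fun u => d M * h M k u).
  by apply/funext => u; rewrite big_ord_recr.
split.
  move=> x; apply: continuousD; first exact: gc.
  apply: continuousM; first exact: cst_continuous.
  exact: hc.
move=> x xab xE; rewrite big_ord_recr /=.
apply: is_deriveD; first exact: gd.
by apply: is_deriveZ; exact: hd.
Qed.

Lemma derivative_towerW (R : realType) (a b a' b' : R) (N : nat) (E : seq R)
    (g : nat -> R -> R) : a <= a' -> b' <= b ->
  derivative_tower a b N E g -> derivative_tower a' b' N E g.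
Proof.
move=> aa bb tg k kN; have [gc gd] := tg k kN; split.
  apply: continuous_subspaceW gc => x /=; rewrite !in_itv /= => /andP[? ?].
  by rewrite (le_trans aa) //= (le_trans _ bb).
move=> x; rewrite in_itv /= => /andP[? ?]; apply: gd.
by rewrite in_itv /= (le_lt_trans aa) //= (lt_le_trans _ bb).
Qed.

(** Induction on the exceptional points: one lying inside the interval splits it in two, and the two
    bounds add up because they are linear in the length. With no exceptional point left this is the
    mean value theorem. *)
Lemma MVT_le_except (R : realType) (h dh : R -> R) (E : seq R) (M a b : R) :
  a <= b -> {within `[a, b], continuous h} ->
  (forall x, x \in `]a, b[ -> x \notin E -> is_derive x 1 h (dh x)) ->
  (forall x, x \in `[a, b] -> `|dh x| <= M) ->
  `|h b - h a| <= M * (b - a).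
Proof.
elim: E a b => [|p E IH] a b ab hc hd hM.
  have [x xab ->] := MVT_segment ab (fun x xab => hd x xab isT) hc.
  rewrite normrM (ger0_norm (_ : 0 <= b - a)) ?subr_ge0 //.
  by apply: ler_wpM2r; rewrite ?subr_ge0 // hM.
have [pab|pab] := boolP (p \in `]a, b[); last first.
  apply: IH => // x xab xE; apply: hd => //.
  by rewrite inE negb_or xE andbT; apply: contraNneq pab => <-.
have /andP[ap pb] : a < p < b by move: pab; rewrite in_itv.
have sub1 : `[a, p] `<=` `[a, b].
  move=> x /=; rewrite !in_itv /= => /andP[-> /=] xp.
  by rewrite (le_trans xp) // ltW.
have sub2 : `[p, b] `<=` `[a, b].
  move=> x /=; rewrite !in_itv /= => /andP[px ->].
  by rewrite (le_trans _ px) // ltW.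
have I1 : `|h p - h a| <= M * (p - a).
  have d1 x : x \in `]a, p[ -> x \notin E -> is_derive x 1 h (dh x).
    rewrite in_itv /= => /andP[ax xp] xE; apply: hd.
      by rewrite in_itv /= ax (lt_trans xp).
    by rewrite inE negb_or xE lt_eqF.
  exact: (IH _ _ (ltW ap) (continuous_subspaceW sub1 hc) d1
            (fun x xI => hM x (sub1 x xI))).
have I2 : `|h b - h p| <= M * (b - p).
  have d2 x : x \in `]p, b[ -> x \notin E -> is_derive x 1 h (dh x).
    rewrite in_itv /= => /andP[px xb] xE; apply: hd.
      by rewrite in_itv /= xb (lt_trans ap).
    by rewrite inE negb_or xE gt_eqF.
  exact: (IH _ _ (ltW pb) (continuous_subspaceW sub2 hc) d2
            (fun x xI => hM x (sub2 x xI))).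
have -> : h b - h a = (h b - h p) + (h p - h a) by ring.
apply: le_trans (ler_normD _ _) _.
have -> : M * (b - a) = M * (b - p) + M * (p - a) by ring.
exact: lerD.
Qed.

(** Each level below [N] vanishes at [a], so descending by one level costs one factor [b - a] by the
    mean value bound. The induction is on the distance [N - k] to the top. *)
Lemma derivative_tower_bound (R : realType) (a b e : R) (N : nat) (E : seq R)
    (g : nat -> R -> R) : derivative_tower a b N E g ->
  (forall k, (k < N)%N -> g k a = 0) ->
  (forall u, u \in `[a, b] -> `|g N u| <= e) ->
  forall k u, (k <= N)%N -> u \in `[a, b] ->
    `|g k u| <= e * (b - a) ^+ (N - k).
Proof.
move=> tg g0 gN k u kN; rewrite -(subKn kN).
elim: (N - k)%N (leq_subr k N) u => {k kN} [|j IH] jN u uab.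
  by rewrite subn0 subnn mulr1; exact: gN.
have kN : (N - j.+1 < N)%N by rewrite ltn_subLR // addSn ltnS leq_addl.
have [gc gd] := tg _ kN.
have e0 : 0 <= e by apply: le_trans (gN u uab); exact: normr_ge0.
have /andP[au ub] : a <= u <= b by move: uab; rewrite in_itv.
rewrite subKn // -[X in `|X|]subr0 -(g0 _ kN).
have -> : e * (b - a) ^+ j.+1 = e * (b - a) ^+ j * (b - a).
  by rewrite exprSr mulrA.
have ba : 0 <= b - a by rewrite subr_ge0 (le_trans au).
apply: (@le_trans _ _ (e * (b - a) ^+ j * (u - a))); last first.
  by apply: ler_wpM2l; [rewrite mulr_ge0 // exprn_ge0|rewrite lerD2r].
have sub x : x \in `[a, u] -> x \in `[a, b].
  by rewrite !in_itv /= => /andP[-> xu]; rewrite (le_trans xu).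
have du x : x \in `]a, u[ -> x \notin E ->
    is_derive x 1 (g (N - j.+1)%N) (g (N - j.+1).+1 x).
  rewrite in_itv /= => /andP[ax xu]; apply: gd.
  by rewrite in_itv /= ax (lt_le_trans xu).
have cu : {within `[a, u], continuous (g (N - j.+1)%N)}.
  by apply: continuous_subspaceW gc => x; exact: sub.
apply: (MVT_le_except au cu du) => x xau; rewrite -subSn // subSS.
apply: le_trans (IH (ltnW jN) x (sub x xau)) _.
by rewrite subKn // ltnW.
Qed.

(** * Divided powers, Taylor monomials and truncated powers *)

Definition divided_pow (R : realType) (m : nat) (u : R) : R :=
  u ^+ m / m`!%:R.

(* The k-th derivative of u |-> (u - s)^j / j!. *)
Definition taylor_monomial (R : realType) (s : R) (j k : nat) (u : R) : R :=
  if (k <= j)%N then divided_pow (j - k) (u - s) else 0.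

(* The k-th derivative of u |-> (u - s)_+^N / N!. *)
Definition truncated_pow (R : realType) (N : nat) (s : R) (k : nat) (u : R) :
    R :=
  if s <= u then divided_pow (N - k) (u - s) else 0.

Lemma divided_pow0 (R : realType) (u : R) : divided_pow 0 u = 1.
Proof. by rewrite /divided_pow expr0 fact0 divr1. Qed.

Lemma divided_powS0 (R : realType) (m : nat) :
  divided_pow m.+1 (0 : R) = 0.
Proof. by rewrite /divided_pow expr0n /= mul0r. Qed.

Lemma is_derive_divided_pow (R : realType) (m : nat) (s x : R) :
  is_derive x 1 (fun u => divided_pow m.+1 (u - s)) (divided_pow m (x - s)).
Proof.
have -> : (fun u => divided_pow m.+1 (u - s)) =
    (m.+1`!%:R^-1 : R) \*: ((@id R - cst s) ^+ m.+1).
  by apply/funext => u; rewrite /divided_pow mulrC /= exprfctE.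
apply: is_derive_eq.
rewrite subr0 /GRing.scale /= mulr1 /divided_pow factS natrM invfM.
have F0 : (m`!%:R : R) != 0 by rewrite pnatr_eq0 -lt0n fact_gt0.
have S0 : (m.+1%:R : R) != 0 by rewrite pnatr_eq0.
by rewrite -[((_ - _) x)]/(x - s); field; rewrite F0 ?natr1 ?nat1r S0.
Qed.

Lemma continuous_divided_pow (R : realType) (m : nat) (s : R) :
  continuous (fun u => divided_pow m (u - s)).
Proof.
case: m => [|m] x.
  under eq_fun do rewrite divided_pow0.
  exact: cvg_cst.
have [+ _] := is_derive_divided_pow m s x.
by move/derivable1_diffP/differentiable_continuous.
Qed.

Lemma taylor_monomial_tower (R : realType) (a b s : R) (N j : nat) (E : seq R) :
  derivative_tower a b N E (taylor_monomial s j).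
Proof.
move=> k kN; rewrite /taylor_monomial; case: (leqP k j) => kj; last first.
  rewrite ltnNge (ltnW kj) /=; split.
    by apply: continuous_subspaceT => x; exact: cvg_cst.
  by move=> x _ _; exact: is_derive_cst.
split.
  by apply: continuous_subspaceT; exact: continuous_divided_pow.
move=> x _ _; case: ltnP => kj1.
  by rewrite -(subnSK kj1); exact: is_derive_divided_pow.
have -> : (j - k = 0)%N by apply/eqP; rewrite subn_eq0.
under eq_fun do rewrite divided_pow0.
exact: is_derive_cst.
Qed.

(** For k < N the exponent N - k is positive, so level k is a divided power of the positive part of
    u - s and hence continuous. Differentiability can fail only at the knot [s], which belongs to
    [E]. *)
Lemma truncated_pow_tower (R : realType) (a b s : R) (N : nat) (E : seq R) :
  s \in E -> derivative_tower a b N E (truncated_pow N s).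
Proof.
move=> sE k kN; split.
  apply: continuous_subspaceT => x.
  have -> : truncated_pow N s k =
      (fun u => divided_pow (N - k) (u - 0)) \o
      ((fun u : R => u - s) \max cst 0).
    apply/funext => u; rewrite /truncated_pow /= subr0.
    case: leP => su; first by rewrite max_l ?subr_ge0.
    by rewrite max_r ?subr_le0 1?ltW // -(subnSK kN) divided_powS0.
  apply: continuous_comp; last exact: continuous_divided_pow.
  apply: continuous_max; last exact: cvg_cst.
  by apply: cvgB; [exact: cvg_id|exact: cvg_cst].
move=> x _ xE; have xs : x != s by apply: contraNneq xE => ->.
move: xs; rewrite neq_lt /truncated_pow => /orP[xs|sx].
  rewrite (leNgt s x) xs /=.
  apply: (@near_eq_is_derive _ _ _ (cst 0)).
  near=> u; rewrite leNgt.
  suff -> : u < s by [].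
  by near: u; exact: lt_nbhsl.
rewrite (ltW sx).
apply: (@near_eq_is_derive _ _ _ (fun u => divided_pow (N - k) (u - s))).
  near=> u; suff -> : s <= u by [].
  by apply: ltW; near: u; exact: lt_nbhsr.
by rewrite -(subnSK kN); exact: is_derive_divided_pow.
Unshelve. all: by end_near. Qed.

(** * Forward differences, divided differences and strong convexity *)

Definition forward_diff (R : realType) (h : R) (F : R -> R) (u : R) : R :=
  F (u + h) - F u.

Lemma is_derive_translate (R : realType) (F : R -> R) (h x d : R) :
  is_derive (x + h) 1 F d -> is_derive x 1 (fun u => F (u + h)) d.
Proof.
have E : (fun h0 : R => h0^-1 *: (((fun u => F (u + h)) \o shift x) (h0 *: 1)
      - F (x + h))) =
    (fun h0 : R => h0^-1 *: ((F \o shift (x + h)) (h0 *: 1) - F (x + h))).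
  by apply/funext => h0 /=; rewrite addrA.
by move=> [dF <-]; split; rewrite /derivable /derive E.
Qed.

(** The right end retreats to [b - h] so that u + h stays in [a, b]. *)
Lemma forward_diff_tower (R : realType) (a b h : R) (N : nat)
    (g : nat -> R -> R) : 0 <= h ->
  derivative_tower a b N [::] g ->
  derivative_tower a (b - h) N [::] (fun k => forward_diff h (g k)).
Proof.
move=> h0 tg; apply: (@derivative_towerB _ _ _ _ _ (fun k u => g k (u + h)) g).
  2: by refine (derivative_towerW _ _ tg); rewrite // gerBl.
move=> k kN; have [/subspace_continuousP gc gd] := tg k kN; split.
  apply/subspace_continuousP => x /= xI.
  have sub u : u \in `[a, b - h] -> u + h \in `[a, b].
    rewrite !in_itv /= lerBrDr => /andP[au ->]; rewrite andbT.
    by rewrite (le_trans au) // lerDl.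
  apply: (@cvg_comp _ _ _ (fun u => u + h) (g k) _ _ _ _
            (gc (x + h) (sub x xI))).
  move=> P; rewrite /within /= => nP.
  have c : (fun u : R => u + h) @ x --> x + h.
    by apply: cvgD; [exact: cvg_id|exact: cvg_cst].
  have cP : nbhs x (fun u => u + h \in `[a, b] -> P (u + h)) := c _ nP.
  have : nbhs x (fun u => u \in `[a, b - h] -> P (u + h)).
    by apply: filterS cP => u Hu uI; apply: Hu; exact: sub.
  by [].
move=> x; rewrite in_itv /= ltrBrDr => /andP[ax xb] _.
apply: is_derive_translate; apply: gd => //.
by rewrite in_itv /= xb andbT (lt_le_trans ax) // lerDl.
Qed.

(** The innermost difference is absorbed into the tower, to which the induction hypothesis applies.
    What remains is h^k times a single first difference of [g k], and the mean value theorem gives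
    the last factor h. *)
Lemma forward_diff_MVT (R : realType) (a b h t : R) (N k : nat)
    (g : nat -> R -> R) : 0 < h -> derivative_tower a b N [::] g ->
  (k <= N)%N -> a <= t -> t + k%:R * h <= b ->
  exists2 xi, xi \in `[t, t + k%:R * h] &
    iter k (forward_diff h) (g 0%N) t = h ^+ k * g k xi.
Proof.
move=> h0; elim: k b g => [|k IH] b g tg kN ab tb.
  by exists t; rewrite ?expr0 ?mul1r // in_itv /= mul0r addr0 lexx.
have tb' : t + k%:R * h <= b - h.
  by rewrite lerBrDr (le_trans _ tb) // -addrA -natr1 mulrDl mul1r.
have [xi xiI] := IH _ _ (forward_diff_tower (ltW h0) tg) (ltnW kN) ab tb'.
rewrite iterSr => ->.
have /andP[txi xit] : t <= xi <= t + k%:R * h by move: xiI; rewrite in_itv.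
have xib : xi + h <= b by rewrite -lerBrDr (le_trans xit).
have xile : xi <= xi + h by rewrite lerDl ltW.
have tg' : derivative_tower xi (xi + h) N [::] g.
  by refine (derivative_towerW _ _ tg); rewrite // (le_trans ab).
have [gc gd] := tg' k kN.
have [z zI E] := MVT_segment xile (fun x xI => gd x xI isT) gc.
exists z; last first.
  rewrite /forward_diff [in LHS]E exprSr.
  by move: (g k.+1 z) (h ^+ k) => p q; ring.
move: zI; rewrite !in_itv /= => /andP[xiz zxi].
rewrite (le_trans txi) //= (le_trans zxi) // -natr1 mulrDl mul1r addrA.
by rewrite lerD2r.
Qed.

(** Dropping the first node replaces [t] by [t + h], and the recursion divides by (n + 1) h at stage
    n + 1; these denominators build up the factorial and the power of h. *)
Lemma divdiff_equispaced (R : realType) (F : R -> R) (h t : R) (n : nat) :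
  h != 0 ->
  divdiff F n (fun i => t + i%:R * h) =
  iter n (forward_diff h) F t / (n`!%:R * h ^+ n).
Proof.
move=> h0; elim: n t => [|n IH] t.
  by rewrite /= mul0r addr0 fact0 mul1r expr0 divr1.
rewrite [LHS]/=.
have -> : (fun i => t + i.+1%:R * h) = (fun i : nat => (t + h) + i%:R * h).
  by apply/funext => i; rewrite -natr1; ring.
rewrite !IH /= {3}/forward_diff factS natrM exprS.
have F0 : (n`!%:R : R) != 0 by rewrite pnatr_eq0 -lt0n fact_gt0.
have S0 : (n.+1%:R : R) != 0 by rewrite pnatr_eq0.
rewrite mul0r addr0 (_ : t + n.+1%:R * h - t = n.+1%:R * h); last by ring.
by field; rewrite F0 ?natr1 ?nat1r S0 h0 expf_neq0.
Qed.

Lemma absolutely_continuous_uniform (R : realType) (a b e : R) (F : R -> R) :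
  absolutely_continuous a b F -> 0 < e ->
  exists2 d, 0 < d & forall u v, u \in `[a, b] -> v \in `[a, b] ->
    `|v - u| < d -> `|F v - F u| < e.
Proof.
move=> acF e0; have [d d0 H] := acF e e0; exists d => // u v.
wlog uv : u v / u <= v.
  move=> W uI vI vu; have [uv|/ltW uv] := leP u v; first exact: W.
  by rewrite distrC; apply: W => //; rewrite distrC.
rewrite !in_itv /= => /andP[au _] /andP[_ vb] vud.
move: uv; rewrite le_eqVlt => /predU1P[->|uv].
  by rewrite subrr normr0.
have := H 1%N (fun=> u) (fun=> v) (fun=> And3 au uv vb).
rewrite !big_ord1; apply.
  by move=> i j _ _ _; rewrite !ord1.
by rewrite -(ger0_norm (_ : 0 <= v - u)) // subr_ge0 ltW.
Qed.

(** The constant [C] may have any sign, hence the choice of e / (|C| + 1). *)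
Lemma ler_of_scaled_eps (R : realType) (x y C : R) :
  (forall e, 0 < e -> x <= y + C * e) -> x <= y.
Proof.
move=> H; apply/ler_addgt0Pr => e e0.
have C0 : 0 < `|C| + 1 by rewrite ltr_wpDl.
apply: le_trans (H (e / (`|C| + 1)) (divr_gt0 e0 C0)) _.
rewrite lerD2l mulrA ler_pdivrMr // mulrC ler_pM2l //.
by apply: le_trans (ler_norm C) _; rewrite lerDl.
Qed.

(** On a fine equispaced grid, strong convexity bounds below the increments of the N-th forward
    difference. These telescope from near [t] to near [v], and an N-th difference is h^N times a
    value of [g N] nearby; uniform continuity moves those values to [t] and [v]. *)
Lemma strongly_convex_derivative_growth (R : realType) (a b c : R) (N : nat)
    (g : nat -> R -> R) (t v : R) :
  derivative_tower a b N [::] g -> absolutely_continuous a b (g N) ->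
  0 <= c -> strongly_convex a b N.+1 c (g 0%N) ->
  a <= t -> t <= v -> v <= b ->
  c * N.+1`!%:R * (v - t) <= g N v - g N t.
Proof.
move=> tg ac c0 cvx lat; rewrite le_eqVlt => /predU1P[->|tv] vb.
  by rewrite !subrr mulr0.
set K := c * _; have K0 : 0 <= K by rewrite mulr_ge0.
have vt0 : 0 < v - t by rewrite subr_gt0.
(* The error is K e for the N grid steps missing from the telescoping sum, plus e at each of the two
   ends. *)
apply: (@ler_of_scaled_eps _ _ _ (K + 2)) => e e0.
have [d d0 unif] := absolutely_continuous_uniform ac e0.
have de0 : 0 < Num.min d e by rewrite lt_min d0.
(* There are [j0 + N] steps in all: [j0] increments are summed, and the last N steps leave room for
   the final N-th difference. The size of [j0] makes the span N h of such a difference smaller than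
   both [d] and [e]. *)
pose j0 := (Num.truncn ((v - t) * N%:R / Num.min d e)).+1.
pose h := (v - t) / (j0 + N)%:R.
have M0 : 0 < (j0 + N)%:R :> R by rewrite ltr0n.
have h0 : 0 < h by rewrite divr_gt0.
have Mh : (j0 + N)%:R * h = v - t by rewrite mulrC divfK // gt_eqF.
have Nh : N%:R * h < Num.min d e.
  rewrite /h mulrCA mulrA ltr_pdivrMr //.
  have : (v - t) * N%:R < j0%:R * Num.min d e.
    by rewrite -ltr_pdivrMr //; exact: truncnS_gt.
  move=> /lt_le_trans; apply; rewrite mulrC ler_pM2l //.
  by rewrite ler_nat leq_addr.
have /andP[Nhd Nhe] : (N%:R * h < d) && (N%:R * h < e) by rewrite -lt_min.
pose D u := iter N (forward_diff h) (g 0%N) u.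
(* The N + 2 nodes starting at t + j h end at index j + N + 1, at most j0 + N, so they stay in
   [t, v]. *)
have step j : (j < j0)%N ->
    K * h * h ^+ N <= D (t + j.+1%:R * h) - D (t + j%:R * h).
  move=> jj0.
  have : c <= divdiff (g 0%N) N.+1 (fun i => (t + j%:R * h) + i%:R * h).
    apply: cvx.
      move=> i; rewrite inE => iN; rewrite in_itv /=; apply/andP; split.
        by rewrite -addrA (le_trans lat) // lerDl addr_ge0 // mulr_ge0 // ltW.
      rewrite (le_trans _ vb) // -addrA -lerBrDl -mulrDl -natrD -Mh.
      have := leq_add jj0 iN; rewrite addSn addnS ltnS => jiM.
      by rewrite ler_pM2r // ler_nat.
    move=> i k _ _ /addrI E; apply/eqP; rewrite -(eqr_nat R); apply/eqP.
    exact: (mulIf (lt0r_neq0 h0) E).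
  rewrite divdiff_equispaced ?gt_eqF //=.
  have F0 : 0 < (N.+1)`!%:R * h ^+ N.+1 :> R.
    by rewrite mulr_gt0 ?exprn_gt0 // ltr0n fact_gt0.
  rewrite ler_pdivlMr // /forward_diff -/(D _) -/(D _) mulrA -/K exprS mulrA.
  by rewrite -natr1 mulrDl mul1r addrA.
have total j : (j <= j0)%N ->
    j%:R * (K * h * h ^+ N) <= D (t + j%:R * h) - D t.
  elim: j => [|j IH] jj0; first by rewrite !mul0r addr0 subrr.
  have := lerD (step j jj0) (IH (ltnW jj0)).
  rewrite addrA subrK; apply: le_trans.
  by rewrite -natr1 mulrDl mul1r addrC.
have tvb : t + N%:R * h <= b.
  rewrite (le_trans _ vb) // -lerBrDl -Mh natrD mulrDl lerDr.
  by rewrite mulr_ge0 // ltW.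
(* The point [x] lies within N h of [t], and below [y] lies within N h of [v]. *)
have [x xI Dx] := forward_diff_MVT h0 tg (leqnn N) lat tvb.
have E2 : t + j0%:R * h + N%:R * h = v.
  by rewrite -addrA -mulrDl -natrD Mh addrC subrK.
have lat2 : a <= t + j0%:R * h.
  by rewrite (le_trans lat) // lerDl mulr_ge0 // ltW.
have tvb2 : t + j0%:R * h + N%:R * h <= b by rewrite E2.
have [y yI Dy] := forward_diff_MVT h0 tg (leqnn N) lat2 tvb2.
have /andP[tx xt] : t <= x <= t + N%:R * h by move: xI; rewrite in_itv.
have /andP[ty yv] : t + j0%:R * h <= y <= v by move: yI; rewrite E2 in_itv.
have := total j0 (leqnn _); rewrite /D Dx Dy -mulrBr mulrA.
rewrite (mulrC (h ^+ N)) ler_pM2r ?exprn_gt0 // => growth.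
have tI : t \in `[a, b] by rewrite in_itv /= lat (le_trans (ltW tv)).
have vI : v \in `[a, b] by rewrite in_itv /= vb (le_trans lat) ?ltW.
have xI' : x \in `[a, b] by rewrite in_itv /= (le_trans lat) ?(le_trans xt).
have yI' : y \in `[a, b] by rewrite in_itv /= (le_trans lat2) ?(le_trans yv).
have : `|g N x - g N t| < e.
  apply: unif => //; rewrite ger0_norm ?subr_ge0 //.
  by apply: le_lt_trans Nhd; rewrite lerBlDl.
have : `|g N v - g N y| < e.
  apply: unif => //; rewrite ger0_norm ?subr_ge0 //.
  by apply: le_lt_trans Nhd; rewrite lerBlDl -lerBlDr -E2 addrK.
rewrite !ltr_norml => /andP[gvy _] /andP[gxt _].
have KN : K * (N%:R * h) <= K * e by rewrite ler_wpM2l // ltW.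
have -> : K * (v - t) = j0%:R * (K * h) + K * (N%:R * h).
  by rewrite -Mh natrD; ring.
lra.
Qed.

(** * Uniform approximation by a step function *)

Lemma step_function_approx (R : realType) (a b d e : R) (G : R -> R) (M : nat) :
  a < b -> 0 <= e -> (0 < M)%N -> (b - a) / M%:R < d ->
  (forall u v, u \in `[a, b] -> v \in `[a, b] -> `|v - u| < d ->
     `|G v - G u| < e) ->
  let t i := a + i%:R * ((b - a) / M%:R) in
  forall u, u \in `[a, b] ->
    `|G u - G a
      - \sum_(i < M) (G (t i.+1) - G (t i)) * (if t i.+1 <= u then 1 else 0)|
    <= e.
Proof.
move=> ab e0 M0 Md unif t u uI.
have ba : 0 < b - a by rewrite subr_gt0.
have MR0 : 0 < M%:R :> R by rewrite ltr0n.
have h0 : 0 < (b - a) / M%:R by rewrite divr_gt0.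
have /andP[au ub] : a <= u <= b by move: uI; rewrite in_itv.
have tS m : t m.+1 = t m + (b - a) / M%:R by rewrite /t -natr1; ring.
have tM : t M = b by rewrite /t mulrC divfK ?gt_eqF // addrC subrK.
have tlt m : t m < t m.+1 by rewrite tS ltrDl.
have tle m : (m <= M)%N -> t m <= b.
  by move=> mM; rewrite -tM /t lerD2l ler_pM2r // ler_nat.
have ta m : a <= t m by rewrite /t lerDl mulr_ge0 // ltW.
pose S m :=
  \sum_(i < m) (G (t i.+1) - G (t i)) * (if t i.+1 <= u then 1 else 0) : R.
(* Jumps at nodes up to [u] telescope exactly; later jumps contribute 0. Once [u] is passed, the
   error is the increment of G from the last node before [u], over a length less than [d]. *)
have claim m : (m <= M)%N ->
    (u < t m -> `|G u - G a - S m| <= e) /\ (t m <= u -> S m = G (t m) - G a).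
  elim: m => [|m IH] mM.
    by rewrite /t mul0r addr0 ltNge au /S big_ord0 subrr.
  have [IHlt IHle] := IH (ltnW mM); rewrite /S big_ord_recr /= -/(S m).
  split=> [utm1|tm1u]; last first.
    by rewrite tm1u mulr1 IHle ?(le_trans (ltW (tlt m))) //; ring.
  rewrite (leNgt (t m.+1)) utm1 /= mulr0 addr0.
  have [utm|tmu] := ltP u (t m); first exact: IHlt.
  rewrite IHle // (_ : _ - _ - _ = G u - G (t m)); last by ring.
  apply/ltW/unif => //; first by rewrite in_itv /= ta tle // ltnW.
  rewrite ger0_norm ?subr_ge0 //; apply: lt_trans Md.
  by rewrite ltrBlDl -tS.
have [+ _] := claim M (leqnn M); have [_] := claim M (leqnn M).
rewrite tM => Sb Slt; have [/Slt//|bu] := ltP u b.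
(* No node exceeds the right endpoint, where every jump is counted and the error is 0. *)
have ubE : u = b by apply/eqP; rewrite eq_le ub.
by rewrite -/(S M) Sb // ubE subrr normr0.
Qed.

(** * From derivatives relative to the closed interval to a tower *)

Lemma n_derivable_in_tower (R : realType) (a b : R) (N : nat) (F : R -> R) :
  n_derivable_in `[a, b] N F ->
  derivative_tower a b N [::] (fun k => deriven_in `[a, b] k F).
Proof.
move=> dF k kN; have {dF kN} := dF k kN.
rewrite [deriven_in _ k.+1 _]/(derive_in _ (deriven_in `[a, b] k F)).
move: (deriven_in _ _ _) => {}F dF; split.
  apply/subspace_continuousP => x xI.
  pose l := derive_in `[a, b] F x.
  have qx : quotient_in `[a, b] F x --> l := dF x xI.
  (* Continuity, endpoints included: F y is F x plus (y - x) times a convergent quotient. The filter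
     is punctured, so y = x is treated separately below. *)
  have c : F x + (y - x) * ((F y - F x) / (y - x)) @[y --> within `[a, b] x^']
      --> F x + (x - x) * l.
    apply: cvgD; first exact: cvg_cst.
    apply: cvgM; last exact: qx.
    apply: cvgB; last exact: cvg_cst.
    apply: (@cvg_trans _ (nbhs x)) => //.
    apply: (@cvg_trans _ (x^')); first exact: cvg_within.
    exact: cvg_within.
  move: c; rewrite subrr mul0r addr0 => /cvgrPdist_lt c.
  apply/cvgrPdist_lt => e e0.
  have c' : nbhs x (fun y : R => y != x -> y \in `[a, b] ->
    `|F x - (F x + (y - x) * ((F y - F x) / (y - x)))| < e) := c e e0.
  suff : nbhs x (fun y : R => y \in `[a, b] -> `|F x - F y| < e) by [].
  apply: filterS c' => y cy yI; have [->|yx] := eqVneq y x.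
    by rewrite subrr normr0.
  have := cy yx yI; rewrite mulrC divfK ?subr_eq0 // addrCA subrr addr0.
  by [].
move=> x xI _.
have xI' : x \in `[a, b] by exact: subset_itv_oo_cc.
have qx : quotient_in `[a, b] F x --> derive_in `[a, b] F x := dF x xI'.
have E : (fun h : R => h^-1 *: ((F \o shift x) (h *: 1) - F x)) =
    (fun y => (F y - F x) / (y - x)) \o (fun h => h + x).
  by apply/funext => h /=; rewrite addrK /GRing.scale /= mulr1 mulrC.
have c : (fun h : R => h^-1 *: ((F \o shift x) (h *: 1) - F x)) @ 0^'
    --> derive_in `[a, b] F x.
  rewrite E; apply: cvg_comp qx => P.
  move=> nP0.
  have nP : nbhs x (fun y : R => y != x -> y \in `[a, b] -> P y) := nP0.
  (* Near an interior point the restriction to the interval is automatic, so the relative limit is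
     the ordinary one. *)
  have nI : nbhs x (fun y => y \in `]a, b[) by exact: near_in_itvoo.
  have c0 : (fun h : R => h + x) @ (0 : R) --> 0 + x.
    by apply: cvgD; [exact: cvg_id|exact: cvg_cst].
  rewrite add0r in c0.
  have nPI := @filterI _ (nbhs x) (nbhs_filter x) _ _ nP nI.
  have c1 := c0 _ nPI.
  have sub (h : R) : (h + x != x -> h + x \in `[a, b] -> P (h + x)) /\
      h + x \in `]a, b[ -> h != 0 -> P (h + x).
    move=> [Ph hI] h0; apply: Ph; first by rewrite -subr_eq0 addrK.
    exact: subset_itv_oo_cc.
  exact: (@filterS _ (nbhs (0 : R)) (nbhs_filter (0 : R)) _ _ sub c1).
by split; [apply/cvg_ex; exists (derive_in `[a, b] F x)|exact: cvg_lim].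
Qed.

(** * The Fink functional on truncated powers and on polynomials *)

Lemma divided_powS (R : realType) (m : nat) (u : R) :
  m.+1%:R * divided_pow m.+1 u = u * divided_pow m u.
Proof.
have F0 : (m`!%:R : R) != 0 by rewrite pnatr_eq0 -lt0n fact_gt0.
have S0 : (m.+1%:R : R) != 0 by rewrite pnatr_eq0.
rewrite /divided_pow factS natrM exprS.
by field; rewrite F0 ?natr1 ?nat1r S0.
Qed.

Lemma divided_powD (R : realType) (m : nat) (u v : R) :
  divided_pow m (u + v) =
  \sum_(i < m.+1) divided_pow (m - i) u * divided_pow i v.
Proof.
rewrite /divided_pow exprDn mulr_suml; apply: eq_bigr => i _.
have im : (i <= m)%N by rewrite -ltnS.
have F0 k : (k`!%:R : R) != 0 by rewrite pnatr_eq0 -lt0n fact_gt0.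
have C0 : ('C(m, i)%:R : R) != 0 by rewrite pnatr_eq0 -lt0n bin_gt0.
rewrite -mulr_natr -(bin_fact im) !natrM.
by field; rewrite !F0 C0.
Qed.

Lemma divided_powD_subl (R : realType) (m : nat) (u v : R) :
  divided_pow m (u + v) - divided_pow m u =
  \sum_(i < m) divided_pow (m - i.+1) u * divided_pow i.+1 v.
Proof.
rewrite divided_powD big_ord_recl subn0 divided_pow0 mulr1.
by rewrite addrAC subrr add0r.
Qed.

(* Written with w = i + 1 and n = N + 1; equal to
   1 / (N! (b - a)) * int (u - t)^N k(t, u) g^(n)(t) dt up to a term which does
   not depend on u. *)
Definition fink_functional (R : realType) (a b : R) (N : nat)
    (g : nat -> R -> R) (u : R) : R :=
  g 0%N u + (b - a)^-1 *
    \sum_(i < N) (N - i)%:R *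
      (g i a * divided_pow i.+1 (u - a) - g i b * divided_pow i.+1 (u - b)).

(** All levels i < N of the truncated power vanish at [a], and those at [b] combine by the binomial
    theorem for u - s = (b - s) + (u - b). The coefficient of (u - s)^N / N! is then the indicator
    of s <= u minus (b - s) / (b - a), which is the kernel over b - a. *)
Lemma fink_functional_truncated_pow (R : realType) (a b s : R) (N : nat)
    (u : R) : a < s -> s <= b ->
  fink_functional a b N (truncated_pow N s) u =
  (N`!%:R * (b - a))^-1 *
    ((u - s) ^+ N * fink_kernel a b s u + (b - s) ^+ N.+1).
Proof.
move=> lt_as le_sb; rewrite /fink_functional.
have ba0 : b - a != 0 by rewrite subr_eq0 gt_eqF // (lt_le_trans lt_as).
have F0 : (N`!%:R : R) != 0 by rewrite pnatr_eq0 -lt0n fact_gt0.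
have -> : \sum_(i < N) (N - i)%:R *
    (truncated_pow N s i a * divided_pow i.+1 (u - a)
     - truncated_pow N s i b * divided_pow i.+1 (u - b)) =
    - (b - s) * (divided_pow N (u - s) - divided_pow N (b - s)).
  rewrite [u - s](_ : _ = (b - s) + (u - b)); last by ring.
  rewrite divided_powD_subl.
  rewrite mulr_sumr; apply: eq_bigr => i _.
  rewrite /truncated_pow leNgt lt_as le_sb /=.
  (* The weight N - i lowers the divided power of b - s by one degree and releases the common factor
     b - s. *)
  rewrite -(subnSK (ltn_ord i)) mul0r sub0r mulrN mulrA divided_powS.
  by ring.
rewrite /truncated_pow /fink_kernel subn0 /divided_pow exprS.
by case: ifP => _; field; rewrite ba0 F0.
Qed.

(** The point is that the value does not depend on [u], so a gap with equal total weights
    annihilates polynomials of degree at most N. *)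
Lemma fink_functional_taylor_monomial (R : realType) (a b : R) (N j : nat)
    (u : R) : a < b -> (j <= N)%N ->
  fink_functional a b N (taylor_monomial a j) u =
  N.+1%:R * divided_pow j.+1 (b - a) / (b - a).
Proof.
move=> lt_ab jN; rewrite /fink_functional.
have ba0 : b - a != 0 by rewrite subr_eq0 gt_eqF.
have atA : \sum_(i < N) (N - i)%:R *
    (taylor_monomial a j i a * divided_pow i.+1 (u - a)) =
    (N - j)%:R * divided_pow j.+1 (u - a).
  have Z i : i != j -> taylor_monomial a j i a = 0.
    rewrite /taylor_monomial subrr; case: ltngtP => // ij _.
    by rewrite -(subnSK ij) divided_powS0.
  have [jN'|jN'] := ltnP j N.
    rewrite (bigD1 (Ordinal jN')) //= big1 ?addr0 => [|i ij].
      by rewrite /taylor_monomial leqnn subnn divided_pow0 mul1r.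
    by rewrite Z ?mul0r ?mulr0.
  have -> : (N - j = 0)%N by apply/eqP; rewrite subn_eq0.
  rewrite mul0r big1 // => i _.
  by rewrite Z ?mul0r ?mulr0 // ltn_eqF // (leq_trans _ jN').
have atB : \sum_(i < N) (N - i)%:R *
    (taylor_monomial a j i b * divided_pow i.+1 (u - b)) =
    N.+1%:R * (divided_pow j.+1 (u - a) - divided_pow j.+1 (b - a))
    - (u - b) * divided_pow j (u - a).
  (* The range can be changed because the term i = N has weight 0 and the terms with i > j
     vanish. *)
  have ext : \sum_(i < N) (N - i)%:R *
      (taylor_monomial a j i b * divided_pow i.+1 (u - b)) =
      \sum_(i < j.+1) (N - i)%:R *
        (taylor_monomial a j i b * divided_pow i.+1 (u - b)).
    pose T i := (N - i)%:R *
      (taylor_monomial a j i b * divided_pow i.+1 (u - b)).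
    transitivity (\sum_(i < N.+1) T i).
      by rewrite big_ord_recr /= /T subnn mul0r addr0.
    rewrite [RHS](big_ord_widen N.+1 T) // [RHS]big_mkcond /=.
    apply: eq_bigr => i _; rewrite /T /taylor_monomial ltnS.
    by case: leqP; rewrite ?mul0r ?mulr0.
  rewrite ext [u - a](_ : _ = (b - a) + (u - b)); last by ring.
  rewrite divided_powD_subl divided_powD.
  rewrite !mulr_sumr -sumrB; apply: eq_bigr => i _.
  have ij : (i <= j)%N by rewrite -ltnS.
  rewrite /taylor_monomial ij subSS.
  rewrite (mulrCA (u - b)) -divided_powS.
  (* The part N + 1 sums to a difference of divided powers of degree j + 1; the part i + 1 is
     absorbed by [divided_powS] and sums to (u - b) times the one of degree j. *)
  have -> : ((N - i)%:R : R) = N.+1%:R - i.+1%:R.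
    by rewrite -natrB ?subSS // ltnS (leq_trans ij).
  by ring.
under eq_bigr do rewrite mulrBr.
rewrite sumrB atA atB.
have -> : taylor_monomial a j 0 u = divided_pow j (u - a).
  by rewrite /taylor_monomial subn0.
have E := divided_powS j (u - a).
have -> : ((N - j)%:R : R) = N.+1%:R - j.+1%:R.
  by rewrite -natrB ?subSS.
rewrite mulrBl E.
by field.
Qed.

(** * Weighted gaps as linear functionals *)

Lemma weighted_majorized_sum (R : realType) (m l : nat) (y b : 'rV[R]_m)
    (x a : 'rV[R]_l) :
  weighted_majorized y b x a -> \sum_j a 0 j = \sum_i b 0 i.
Proof.
move=> [A [[_ A1] -> _]]; under eq_bigr do rewrite mxE.
rewrite exchange_big; apply: eq_bigr => i _.
by rewrite -mulr_sumr A1 mulr1.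
Qed.

Lemma weighted_gapB (R : realType) (m l : nat) (y b : 'rV[R]_m)
    (x a : 'rV[R]_l) (g h : R -> R) :
  weighted_gap y b x a (fun u => g u - h u) =
  weighted_gap y b x a g - weighted_gap y b x a h.
Proof.
rewrite /weighted_gap.
under eq_bigr do rewrite mulrBr.
under [X in _ - X]eq_bigr do rewrite mulrBr.
by rewrite !sumrB; ring.
Qed.

Lemma weighted_gapZ (R : realType) (m l : nat) (y b : 'rV[R]_m)
    (x a : 'rV[R]_l) (k : R) (g : R -> R) :
  weighted_gap y b x a (fun u => k * g u) = k * weighted_gap y b x a g.
Proof.
rewrite /weighted_gap mulrBr !mulr_sumr.
by congr (_ - _); apply: eq_bigr => i _; rewrite mulrCA.
Qed.

Lemma weighted_gap_sum (R : realType) (m l M : nat) (y b : 'rV[R]_m)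
    (x a : 'rV[R]_l) (g : 'I_M -> R -> R) :
  weighted_gap y b x a (fun u => \sum_(i < M) g i u) =
  \sum_(i < M) weighted_gap y b x a (g i).
Proof.
rewrite /weighted_gap sumrB.
by congr (_ - _); rewrite exchange_big; apply: eq_bigr => i _;
  rewrite mulr_sumr.
Qed.

(** This removes the terms independent of [u] that the Fink functional produces on monomials and
    truncated powers. *)
Lemma weighted_gap_cst (R : realType) (m l : nat) (y b : 'rV[R]_m)
    (x a : 'rV[R]_l) (k : R) : \sum_j a 0 j = \sum_i b 0 i ->
  weighted_gap y b x a (fun=> k) = 0.
Proof. by move=> ab; rewrite /weighted_gap -!mulr_suml ab subrr. Qed.

Lemma weighted_gapD_cst (R : realType) (m l : nat) (y b : 'rV[R]_m)
    (x a : 'rV[R]_l) (g : R -> R) (k : R) : \sum_j a 0 j = \sum_i b 0 i ->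
  weighted_gap y b x a (fun u => g u + k) = weighted_gap y b x a g.
Proof.
move=> ab; rewrite -[RHS]subr0 -(weighted_gap_cst y x (- k) ab) -weighted_gapB.
by congr weighted_gap; apply/funext => u; rewrite opprK.
Qed.

Lemma weighted_gap_bound (R : realType) (m l : nat) (y b : 'rV[R]_m)
    (x a : 'rV[R]_l) (A : set R) (g : R -> R) (E : R) :
  (forall j, 0 <= a 0 j) -> (forall i, 0 <= b 0 i) ->
  (forall j, A (x 0 j)) -> (forall i, A (y 0 i)) ->
  (forall u, A u -> `|g u| <= E) ->
  `|weighted_gap y b x a g| <= (\sum_j a 0 j + \sum_i b 0 i) * E.
Proof.
move=> a0 b0 xA yA gE; apply: le_trans (ler_normB _ _) _.
rewrite mulrDl !mulr_suml.
by apply: lerD; apply: le_trans (ler_norm_sum _ _ _) _; apply: ler_sum => i _;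
  rewrite normrM ger0_norm // ler_wpM2l // gE.
Qed.

(** * Linearity, boundedness and approximation of the Fink functional *)

Lemma fink_functionalB (R : realType) (a b : R) (N : nat)
    (g h : nat -> R -> R) (u : R) :
  fink_functional a b N (fun k u => g k u - h k u) u =
  fink_functional a b N g u - fink_functional a b N h u.
Proof.
rewrite /fink_functional [RHS](_ : _ = g 0%N u - h 0%N u + (b - a)^-1 * (
   \sum_(i < N) (N - i)%:R *
      (g i a * divided_pow i.+1 (u - a) - g i b * divided_pow i.+1 (u - b))
   - \sum_(i < N) (N - i)%:R *
      (h i a * divided_pow i.+1 (u - a) - h i b * divided_pow i.+1 (u - b))));
  last by ring.
rewrite -sumrB; congr (_ + _ * _).
by apply: eq_bigr => i _; ring.
Qed.

Lemma fink_functional_sum (R : realType) (a b : R) (N M : nat) (d : nat -> R)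
    (h : nat -> nat -> R -> R) (u : R) :
  fink_functional a b N (fun k u => \sum_(i < M) d i * h i k u) u =
  \sum_(i < M) d i * fink_functional a b N (h i) u.
Proof.
elim: M => [|M IH].
  rewrite big_ord0 /fink_functional !big_ord0 add0r big1 ?mulr0 // => i _.
  by rewrite !big_ord0 !mul0r subrr mulr0.
rewrite big_ord_recr /= -IH /fink_functional big_ord_recr /= mulrDr.
rewrite mulrCA [d M * \sum_(i < N) _]mulr_sumr addrACA -mulrDr -big_split /=.
congr (_ + _ * _); apply: eq_bigr => i _; rewrite !big_ord_recr /=.
by ring.
Qed.

(** The constant is fixed before [g], so it serves for remainders that vary with the precision. *)
Lemma fink_functional_bound (R : realType) (a b : R) (N : nat) : a < b ->
  exists2 C : R, 0 <= C & forall (g : nat -> R -> R) (E : R),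
    (forall k u, (k <= N)%N -> u \in `[a, b] -> `|g k u| <= E) ->
    forall u, u \in `[a, b] -> `|fink_functional a b N g u| <= C * E.
Proof.
move=> ab; have ba : 0 < b - a by rewrite subr_gt0.
have dp0 i (v : R) : 0 <= v -> 0 <= divided_pow i v.
  by move=> v0; rewrite /divided_pow divr_ge0 // exprn_ge0.
have dpb i (v : R) : `|v| <= b - a ->
    `|divided_pow i v| <= divided_pow i (b - a).
  move=> vb; rewrite /divided_pow normrM normrX [X in _ * X]ger0_norm //.
  by rewrite ler_wpM2r // lerXn2r // nnegrE ltW.
exists (1 + (b - a)^-1 *
    \sum_(i < N) (N - i)%:R * (2 * divided_pow i.+1 (b - a))).
  rewrite addr_ge0 // mulr_ge0 ?invr_ge0 ?(ltW ba) // sumr_ge0 // => i _.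
  by apply: mulr_ge0 => //; apply: mulr_ge0 => //; exact/dp0/ltW.
move=> g E gE u uI; have /andP[au ub] : a <= u <= b by move: uI; rewrite in_itv.
have aI : a \in `[a, b] by rewrite in_itv /= lexx ltW.
have bI : b \in `[a, b] by rewrite in_itv /= lexx ltW.
have E0 : 0 <= E by apply: le_trans (gE 0%N u (leq0n _) uI); exact: normr_ge0.
rewrite mulrDl mul1r; apply: le_trans (ler_normD _ _) _.
apply: lerD; first exact: gE.
rewrite normrM ger0_norm ?invr_ge0 ?(ltW ba) // -mulrA ler_wpM2l //.
  by rewrite invr_ge0 ltW.
rewrite mulr_suml; apply: le_trans (ler_norm_sum _ _ _) _.
apply: ler_sum => i _; rewrite normrM ger0_norm // -mulrA ler_wpM2l //.
apply: le_trans (ler_normB _ _) _.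
rewrite (_ : 2 * _ * E = E * divided_pow i.+1 (b - a)
  + E * divided_pow i.+1 (b - a)); last by ring.
have iN : (i <= N)%N by rewrite ltnW.
apply: lerD; rewrite normrM; apply: ler_pM => //.
- exact: gE.
- by apply: dpb; rewrite ger0_norm ?subr_ge0 // lerD2r.
- exact: gE.
- by apply: dpb; rewrite distrC ger0_norm ?subr_ge0 // lerD2l lerN2.
Qed.

(** A finite substitute for the integral of the kernel gap against the increasing function [g N]:
    the [d i] are normalized increments of [g N], hence nonnegative, and [C] is chosen before
    [e]. *)
Lemma fink_gap_approx (R : realType) (alpha beta : R) (N m l : nat)
    (y b : 'rV[R]_m) (x a : 'rV[R]_l) (g : nat -> R -> R) :
  alpha < beta ->
  (forall j, x 0 j \in `[alpha, beta]) ->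
  (forall i, y 0 i \in `[alpha, beta]) ->
  (forall j, 0 <= a 0 j) -> (forall i, 0 <= b 0 i) ->
  \sum_j a 0 j = \sum_i b 0 i ->
  derivative_tower alpha beta N [::] g ->
  (forall e, 0 < e -> exists2 d, 0 < d & forall u v,
     u \in `[alpha, beta] -> v \in `[alpha, beta] -> `|v - u| < d ->
     `|g N v - g N u| < e) ->
  (forall u v, alpha <= u -> u <= v -> v <= beta -> g N u <= g N v) ->
  exists C, forall e, 0 < e -> exists M (s d : nat -> R),
    (forall i, (i < M)%N -> 0 <= d i /\ s i \in `[alpha, beta]) /\
    `|weighted_gap y b x a (fink_functional alpha beta N g)
      - \sum_(i < M) d i * weighted_gap y b x a
          (fun u => (u - s i) ^+ N * fink_kernel alpha beta (s i) u)|
      <= C * e.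
Proof.
move=> ab xI yI a0 b0 sums tg unif mono.
have ba : 0 < beta - alpha by rewrite subr_gt0.
have aI : alpha \in `[alpha, beta] by rewrite in_itv /= lexx ltW.
have [C0 C00 finkC] := @fink_functional_bound R alpha beta N ab.
(* The factors are the total weight, the norm bound of the functional, and the loss in descending N
   levels of the tower. *)
exists ((\sum_j a 0 j + \sum_i b 0 i)
  * (C0 * (1 + (beta - alpha)) ^+ N)) => e e0.
have [d d0 gd] := unif e e0.
pose M := (Num.truncn ((beta - alpha) / d)).+1.
have M0 : 0 < M%:R :> R by rewrite ltr0n.
have Md : (beta - alpha) / M%:R < d.
  rewrite ltr_pdivrMr // mulrC -ltr_pdivrMr //.
  exact: truncnS_gt.
pose h := (beta - alpha) / M%:R; have h0 : 0 < h by rewrite divr_gt0.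
pose t (i : nat) := alpha + i%:R * h.
(* The knots are the right ends of the cells: strictly above [alpha], as the truncated power formula
   requires, the last one being [beta]. *)
have at1 i : alpha < t i.+1 by rewrite /t ltrDl mulr_gt0.
have tle i : (i <= M)%N -> t i <= beta.
  move=> iM; rewrite /t -lerBrDl /h mulrA ler_pdivrMr // mulrC ler_pM2l //.
  by rewrite ler_nat.
have ta i : alpha <= t i by rewrite /t lerDl mulr_ge0 // ltW.
have tS i : t i <= t i.+1 by rewrite /t lerD2l ler_pM2r // ler_nat.
pose dG i := g N (t i.+1) - g N (t i).
have dG0 i : (i < M)%N -> 0 <= dG i.
  by move=> iM; rewrite subr_ge0 mono // tle.
(* [P] is the Taylor polynomial at [alpha], [T] carries the jumps of the step function, and [W] is
   the remainder, each with its derivatives. *)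
pose P k u := \sum_(j < N.+1) g j alpha * taylor_monomial alpha j k u.
pose T k u := \sum_(i < M) dG i * truncated_pow N (t i.+1) k u.
pose W k u := g k u - P k u - T k u.
pose E := [seq t i.+1 | i <- iota 0 M].
have tW : derivative_tower alpha beta N E W.
  apply: derivative_towerB.
    apply: derivative_towerB.
      by move=> k kN; have [gc gD] := tg k kN; split=> // z zI _; exact: gD.
    apply: (@derivative_tower_sum _ _ _ _ _ _ (fun j => g j alpha)) => j _.
    exact: taylor_monomial_tower.
  apply: (@derivative_tower_sum _ _ _ _ _ _ dG
           (fun i => truncated_pow N (t i.+1))) => i iM.
  by apply: truncated_pow_tower; apply/mapP; exists i; rewrite ?mem_iota.
have W0 k : (k < N)%N -> W k alpha = 0.
  move=> kN; rewrite /W /P /T [X in _ - _ - X]big1 ?subr0 => [|i _]; last first.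
    by rewrite /truncated_pow leNgt at1 mulr0.
  have kN1 : (k < N.+1)%N by rewrite ltnW.
  rewrite (bigD1 (Ordinal kN1)) //= big1 ?addr0 => [|j].
    by rewrite /taylor_monomial leqnn subnn divided_pow0 mulr1 subrr.
  rewrite -val_eqE /= /taylor_monomial subrr; case: (ltngtP k j) => // kj _.
    by rewrite -(subnSK kj) divided_powS0 mulr0.
  by rewrite mulr0.
(* At level N the polynomial is the constant [g N alpha] and [T] is the step function itself. *)
have WN u : u \in `[alpha, beta] -> `|W N u| <= e.
  move=> uI; have -> : W N u = g N u - g N alpha
      - \sum_(i < M) (g N (t i.+1) - g N (t i))
          * (if t i.+1 <= u then 1 else 0).
    rewrite /W; congr (_ - _ - _).
      rewrite /P big_ord_recr /= big1 ?add0r => [|j _].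
        by rewrite /taylor_monomial leqnn subnn divided_pow0 mulr1.
      by rewrite /taylor_monomial leqNgt ltn_ord mulr0.
    rewrite /T; apply: eq_bigr => i _.
    by rewrite /truncated_pow subnn divided_pow0.
  exact: (step_function_approx ab (ltW e0) _ Md gd).
have Wb k u : (k <= N)%N -> u \in `[alpha, beta] ->
    `|W k u| <= (1 + (beta - alpha)) ^+ N * e.
  move=> kN uI; apply: le_trans (derivative_tower_bound tW W0 WN kN uI) _.
  rewrite mulrC ler_pM2r //.
  (* Adding 1 to the base makes the power monotone in the exponent, which gives one bound for all
     levels k. *)
  have B1 : 1 <= 1 + (beta - alpha) by rewrite lerDl ltW.
  apply: (@le_trans _ _ ((1 + (beta - alpha)) ^+ (N - k))).
    have B0 : 0 <= 1 + (beta - alpha) := le_trans ler01 B1.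
    by apply: lerXn2r; rewrite ?nnegrE ?(ltW ba) // lerDr.
  by rewrite ler_weXn2l // leq_subr.
pose K i := (N`!%:R * (beta - alpha))^-1 * dG i.
have F0 : 0 < N`!%:R * (beta - alpha).
  by rewrite mulr_gt0 // ltr0n fact_gt0.
exists M, (fun i => t i.+1), K; split.
  move=> i iM; split; first by rewrite mulr_ge0 ?invr_ge0 ?(ltW F0) ?dG0.
  by rewrite in_itv /= ta tle.
have gapP : weighted_gap y b x a (fink_functional alpha beta N P) = 0.
  have -> : fink_functional alpha beta N P = fun=>
      \sum_(j < N.+1) g j alpha *
        (N.+1%:R * divided_pow j.+1 (beta - alpha) / (beta - alpha)).
    apply/funext => u.
    rewrite (@fink_functional_sum _ _ _ _ _ (fun j => g j alpha)).
    apply: eq_bigr => j _.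
    by rewrite fink_functional_taylor_monomial // -ltnS.
  exact: weighted_gap_cst.
have gapT : weighted_gap y b x a (fink_functional alpha beta N T) =
    \sum_(i < M) K i * weighted_gap y b x a
      (fun u => (u - t i.+1) ^+ N * fink_kernel alpha beta (t i.+1) u).
  have -> : fink_functional alpha beta N T = fun u => \sum_(i < M)
      dG i * fink_functional alpha beta N (truncated_pow N (t i.+1)) u.
    apply/funext => u.
    exact: (@fink_functional_sum _ _ _ _ _ dG
             (fun i => truncated_pow N (t i.+1))).
  rewrite weighted_gap_sum; apply: eq_bigr => i _.
  rewrite weighted_gapZ /K -mulrA mulrCA; congr (_ * _).
  have -> : fink_functional alpha beta N (truncated_pow N (t i.+1)) = fun u =>
      (N`!%:R * (beta - alpha))^-1 *
      ((u - t i.+1) ^+ N * fink_kernel alpha beta (t i.+1) u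
       + (beta - t i.+1) ^+ N.+1).
    by apply/funext => u; rewrite fink_functional_truncated_pow // tle.
  by rewrite weighted_gapZ weighted_gapD_cst.
have gapW : weighted_gap y b x a (fink_functional alpha beta N W) =
    weighted_gap y b x a (fink_functional alpha beta N g)
    - weighted_gap y b x a (fink_functional alpha beta N T).
  have -> : fink_functional alpha beta N W = fun u =>
      (fink_functional alpha beta N g u - fink_functional alpha beta N P u)
      - fink_functional alpha beta N T u.
    by apply/funext => u; rewrite !fink_functionalB.
  by rewrite !weighted_gapB gapP subr0.
rewrite -gapT -gapW -mulrA -[C0 * _ * e]mulrA.
apply: (@weighted_gap_bound _ _ _ _ _ _ _ `[alpha, beta]) => // u uI.
exact: finkC.
Qed.

(** * Reduction to f(u) - c u^n and passage to the limit *)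

Theorem theorem5 (R : realType) (alpha beta : R) (n l m : nat)
    (x a : 'rV[R]_l) (y b : 'rV[R]_m) (f : R -> R) (c : R)
    (alpha_gt0 : 0 < alpha) (alpha_lt_beta : alpha < beta) (n_ge1 : (1 <= n)%N)
    (hx : forall j, x 0 j \in `[alpha, beta])
    (hy : forall i, y 0 i \in `[alpha, beta])
    (ha : forall j, 0 <= a 0 j)
    (hb : forall i, 0 <= b 0 i)
    (maj : weighted_majorized y b x a)
    (f_derivable : n_derivable_in `[alpha, beta] n.-1 f)
    (f_ac : absolutely_continuous alpha beta
              (deriven_in `[alpha, beta] n.-1 f))
    (c_gt0 : 0 < c)
    (f_convex : strongly_convex alpha beta n c f) :
  let kernel_gap t :=
    weighted_gap y b x a (fun u => (u - t) ^+ n.-1 * fink_kernel alpha beta t u)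
  in
  let lhs :=
    weighted_gap y b x a f - c * weighted_gap y b x a (fun u => u ^+ n) in
  let rhs :=
    (beta - alpha)^-1 * endpoint_sum y b x a alpha beta n c f beta
    - (beta - alpha)^-1 * endpoint_sum y b x a alpha beta n c f alpha in
  ((forall t, t \in `[alpha, beta] -> kernel_gap t >= 0) -> lhs >= rhs) /\
  ((forall t, t \in `[alpha, beta] -> kernel_gap t <= 0) -> lhs <= rhs).
Proof.
case: n n_ge1 f_derivable f_ac f_convex => // N _ f_derivable f_ac f_convex.
move=> kernel_gap lhs rhs; rewrite /= in f_derivable f_ac.
have sums := weighted_majorized_sum maj.
pose K := c * N.+1`!%:R.
have K0 : 0 <= K by rewrite mulr_ge0 // ltW.
(* The tower of c u^(N+1), written as a one-term sum so that the lemma on sums of towers applies. *)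
pose q k u := \sum_(i < 1) K * taylor_monomial 0 N.+1 k u.
pose fk k := deriven_in `[alpha, beta] k f.
pose g k u := fk k u - q k u.
have qE k u : (k <= N)%N -> q k u = c * (N.+1 ^_ k)%:R * u ^+ (N.+1 - k).
  move=> kN; have kN1 : (k <= N.+1)%N := leqW kN.
  rewrite /q big_ord1 /taylor_monomial kN1 subr0 /divided_pow /K.
  rewrite -(ffact_fact kN1) natrM.
  have F0 : ((N.+1 - k)`!%:R : R) != 0 by rewrite pnatr_eq0 -lt0n fact_gt0.
  by field.
have tf : derivative_tower alpha beta N [::] fk :=
  n_derivable_in_tower f_derivable.
have tg : derivative_tower alpha beta N [::] g.
  apply: derivative_towerB tf _.
  apply: (@derivative_tower_sum _ _ _ _ _ _ (fun=> K)
            (fun=> taylor_monomial 0 N.+1)) => i _.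
  exact: taylor_monomial_tower.
have gN u : g N u = fk N u - K * u.
  rewrite /g qE // subSnn expr1 /K; congr (_ - c * _%:R * _).
  by rewrite -ffactnn ffactnSr subSnn muln1.
(* The growth rate [K] given by strong convexity is exactly the slope of [q N]. *)
have gN_mono u v : alpha <= u -> u <= v -> v <= beta -> g N u <= g N v.
  move=> au uv vb; rewrite !gN -subr_ge0.
  have := strongly_convex_derivative_growth tf f_ac (ltW c_gt0) f_convex
    au uv vb.
  by rewrite -/K -subr_ge0; congr (0 <= _); ring.
have gN_unif e : 0 < e -> exists2 d, 0 < d & forall u v,
    u \in `[alpha, beta] -> v \in `[alpha, beta] -> `|v - u| < d ->
    `|g N v - g N u| < e.
  move=> e0; have e20 : 0 < e / 2 by rewrite divr_gt0.
  have [d d0 fd] := absolutely_continuous_uniform f_ac e20.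
  have K1 : 0 < K + 1 by rewrite ltr_wpDl.
  exists (Num.min d (e / 2 / (K + 1))); first by rewrite lt_min d0 divr_gt0.
  move=> u v uI vI; rewrite lt_min => /andP[/(fd u v uI vI) fuv].
  rewrite ltr_pdivlMr // => uvK; rewrite !gN.
  rewrite (_ : _ - _ = (fk N v - fk N u) - K * (v - u)); last by ring.
  apply: le_lt_trans (ler_normB _ _) _; rewrite normrM (ger0_norm K0).
  have : K * `|v - u| <= `|v - u| * (K + 1).
    by rewrite mulrC ler_wpM2l // lerDl.
  by move: fuv uvK; rewrite -/(fk N); lra.
have [C approx] :=
  fink_gap_approx alpha_lt_beta hx hy ha hb sums tg gN_unif gN_mono.
have key : lhs - rhs = weighted_gap y b x a (fink_functional alpha beta N g).
  (* Here w = i + 1: the factor 1 / w! goes into the divided power and the bracket is [g i e]. *)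
  have endE e : endpoint_sum y b x a alpha beta N.+1 c f e =
      weighted_gap y b x a (fun u =>
        \sum_(i < N) (N - i)%:R * (g i e * divided_pow i.+1 (u - e))).
    rewrite /endpoint_sum big_add1 big_mkord weighted_gap_sum.
    apply: eq_bigr => i _ /=; rewrite /g qE ?(ltnW (ltn_ord i)) //.
    rewrite -weighted_gapZ; congr weighted_gap; apply/funext => u.
    rewrite subSS addn1 -subSn ?(ltnW (ltn_ord i)) // /divided_pow /fk.
    rewrite -!mulrA; congr (_ * _); rewrite mulrCA; congr (_ * _).
    by rewrite mulrC.
  rewrite /lhs /rhs !endE.
  rewrite -!weighted_gapZ -!weighted_gapB.
  congr weighted_gap; apply/funext => u.
  have -> : f u - c * u ^+ N.+1 = g 0%N u.
    by rewrite /g qE // ffactn0 subn0 mulr1.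
  rewrite /fink_functional; under [in RHS]eq_bigr do rewrite mulrBr.
  by rewrite sumrB mulrBr opprB.
(* In both directions the approximating sum has the sign of the kernel gap, and the error C e is
   removed by letting e tend to 0. *)
split=> kg; rewrite -subr_ge0.
  rewrite key; apply: (@ler_of_scaled_eps _ _ _ C) => e e0.
  have [M [s [d [sd]]]] := approx e e0.
  rewrite ler_norml => /andP[+ _]; rewrite lerBrDl => H.
  rewrite -lerBlDr sub0r; apply: le_trans H; rewrite lerDr.
  apply: sumr_ge0 => i _; have [di si] := sd i (ltn_ord i).
  by rewrite mulr_ge0 // kg.
rewrite -opprB key oppr_ge0; apply: (@ler_of_scaled_eps _ _ _ C) => e e0.
have [M [s [d [sd]]]] := approx e e0.
rewrite ler_norml => /andP[_ +]; rewrite lerBlDl => H.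
apply: le_trans H _; rewrite lerD2r.
apply: sumr_le0 => i _; have [di si] := sd i (ltn_ord i).
by rewrite mulr_ge0_le0 // kg.
Qed.
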